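(* For all real numbers $a \geq 2$ and $b \geq 3$, $$\nu(a,b) < ab-\Delta(a).$$ Moreover, for all real numbers $a,b \geq 3$, $$\nu(a,b) < ab-\max\{\Delta(a),\Delta(b)\}.$$
   Context: For a real number $t \geq 2$, $\Delta(t) = t+1-\lceil t\rceil$. For positive real numbers $a$ and $b$, $\nu(a,b)$ denotes the maximum number of unit squares with pairwise disjoint interiors that can be packed in some $a'\times b'$ rectangle with $a' < a$ and $b' < b$. The unit squares (closed squares of side length $1$) may be translated and rotated independently. *)

(* Defs.v *)
From HB Require Import structures.
From mathcomp Require Import all_boot all_order all_algebra.
From mathcomp Require Import all_classical all_reals all_analysis.
From mathcomp Require Import ring lra.

Set Implicit Arguments.
Unset Strict Implicit.
Unset Printing Implicit Defensive.

Import Order.TTheory GRing.Theory Num.Theory.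
Import numFieldNormedType.Exports.

Local Open Scope classical_set_scope.
Local Open Scope ring_scope.

Section Defs.
Context {R : realType}.
Implicit Types (p z : R * R) (theta a b : R).

Definition Delta (t : R) : R := t + 1 - (Num.ceil t)%:~R.

Definition rotate theta p : R * R :=
  (cos theta * p.1 - sin theta * p.2, sin theta * p.1 + cos theta * p.2).

(* Centred at the origin, so that z below is the centre of the placed square. *)
Definition unit_square : set (R * R) :=
  `[- 2^-1, 2^-1]%classic `*` `[- 2^-1, 2^-1]%classic.

Definition placed_square z theta : set (R * R) :=
  [set z + rotate theta p | p in unit_square].

Definition rectangle a b : set (R * R) := `[0, a]%classic `*` `[0, b]%classic.

Definition packs (n : nat) (A : set (R * R)) : Prop :=
  exists (z : 'I_n -> R * R) (theta : 'I_n -> R),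
    (forall i, placed_square (z i) (theta i) `<=` A) /\
    trivIset [set: 'I_n] (fun i => (placed_square (z i) (theta i))°).

(* Up to a rigid motion, every a' x b' rectangle is [rectangle a' b']. *)
Definition packable a b (n : nat) : Prop :=
  exists a' b' : R, [/\ 0 < a' < a, 0 < b' < b & packs n (rectangle a' b')].

(* The default value 0 is irrelevant for positive [a] and [b]: see [nu_max]. *)
Definition nu a b : nat :=
  xget 0%N [set n | packable a b n /\
                    forall m : nat, packable a b m -> (m <= n)%N].

Lemma packable0 a b : 0 < a -> 0 < b -> packable a b 0.
Proof.
move=> a0 b0; exists (a / 2), (b / 2); split; [lra|lra|].
by exists (fun=> 0), (fun=> 0); split=> [[]//|[]].
Qed.

Lemma placed_square_near z theta p :
  `|p.1 - z.1| < 4^-1 -> `|p.2 - z.2| < 4^-1 -> placed_square z theta p.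
Proof.
move=> h1 h2; set x := p.1 - z.1; set y := p.2 - z.2.
have c2 := cos2Dsin2 theta; have := cos_max theta; have := sin_max theta.
set c := cos theta; set s := sin theta => s1 c1.
exists (c * x + s * y, c * y - s * x); last first.
  rewrite [LHS]surjective_pairing [RHS]surjective_pairing /rotate /= -/c -/s.
  congr pair.
    transitivity (z.1 + (c ^+ 2 + s ^+ 2) * x); first ring.
    by rewrite c2 /x; ring.
  transitivity (z.2 + (c ^+ 2 + s ^+ 2) * y); first ring.
  by rewrite c2 /y; ring.
have le (u v : R) : `|u| <= 1 -> `|v| < 4^-1 -> `|u * v| <= 4^-1.
  move=> u1 v1; rewrite normrM -[leRHS]mul1r; apply: ler_pM => //; exact: ltW.
have := le _ _ c1 h1; have := le _ _ s1 h2.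
have := le _ _ c1 h2; have := le _ _ s1 h1.
rewrite -/x -/y !ler_norml => /andP[? ?] /andP[? ?] /andP[? ?] /andP[? ?].
split; rewrite /= in_itv /=; apply/andP; split; lra.
Qed.

Lemma interior_placed_square_near z theta p :
  `|p.1 - z.1| < 8^-1 -> `|p.2 - z.2| < 8^-1 -> (placed_square z theta)° p.
Proof.
move=> h1 h2; rewrite /interior /=; apply/nbhs_ballP; exists (8^-1 : R) => /=.
  by rewrite invr_gt0.
move=> q [/= q1 q2]; move: h1 h2 q1 q2; rewrite /ball /= !ltr_norml.
move=> /andP[? ?] /andP[? ?] /andP[? ?] /andP[? ?].
apply: placed_square_near; rewrite ltr_norml; apply/andP; split; lra.
Qed.

Lemma packable_bounded a b :
  exists M : nat, forall n : nat, packable a b n -> (n <= M)%N.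
Proof.
pose A := Num.truncn (8 * a); pose B := Num.truncn (8 * b).
exists (A.+1 * B.+1)%N => n [a' [b' [/andP[a'0 a'a] /andP[b'0 b'b]]]].
move=> [z [theta [sub triv]]].
have zin i : (0 <= (z i).1 <= a') && (0 <= (z i).2 <= b').
  have /sub[/=] : placed_square (z i) (theta i) (z i).
    by apply: placed_square_near; rewrite subrr normr0 invr_gt0.
  by rewrite !in_itv /= => -> ->.
have cell (x y : R) : 0 <= x -> 0 <= y ->
    Num.truncn (8 * x) = Num.truncn (8 * y) -> `|x - y| < 8^-1.
  move=> x0 y0 xy.
  have /truncn_itv : 0 <= 8 * x by rewrite mulr_ge0.
  have /truncn_itv : 0 <= 8 * y by rewrite mulr_ge0.
  rewrite xy -[X in _ < X]natr1 => /andP[? ?] /andP[? ?].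
  by rewrite ltr_norml; apply/andP; split; lra.
pose f i : 'I_A.+1 * 'I_B.+1 :=
  (inord (Num.truncn (8 * (z i).1)), inord (Num.truncn (8 * (z i).2))).
suff /leq_card : injective f by rewrite card_prod !card_ord.
move=> i j; case=> /(congr1 val) /= fij1 /(congr1 val) /= fij2.
move: (zin i) (zin j) => /andP[/andP[? ?] /andP[? ?]].
move=> /andP[/andP[? ?] /andP[? ?]].
have ltA x : x <= a' -> (Num.truncn (8 * x) < A.+1)%N.
  by move=> xa; rewrite ltnS; apply: le_truncn; lra.
have ltB x : x <= b' -> (Num.truncn (8 * x) < B.+1)%N.
  by move=> xb; rewrite ltnS; apply: le_truncn; lra.
rewrite !inordK ?ltA// in fij1; rewrite !inordK ?ltB// in fij2.
apply: triv => //; exists (z j); split; apply: interior_placed_square_near.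
- by apply: cell.
- by apply: cell.
- by rewrite subrr normr0 invr_gt0.
- by rewrite subrr normr0 invr_gt0.
Qed.

Lemma nu_max a b : 0 < a -> 0 < b ->
  packable a b (nu a b) /\ forall m : nat, packable a b m -> (m <= nu a b)%N.
Proof.
move=> a0 b0; suff : exists n, packable a b n /\
    forall m : nat, packable a b m -> (m <= n)%N by move/(xgetPex 0%N).
have [M ub] := packable_bounded a b.
have exP : exists n, `[< packable a b n >].
  by exists 0%N; apply/asboolP; exact: packable0.
have ubP n : `[< packable a b n >] -> (n <= M)%N by move/asboolP/ub.
case: (ex_maxnP exP ubP) => n /asboolP pn nmax.
by exists n; split=> // m pm; apply: nmax; apply/asboolP.
Qed.

End Defs.

(* Main.v *)
(* Let the rectangle be A x B with A < k + 1, and let h be slightly below 1. Give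
   a square the score consisting of its area between the lines y = h and
   y = B - h, half the lengths of its chords on these two lines, and 1/2 for each
   of the two rows of k equally spaced points, at heights h - 1/8 and
   B - h + 1/8, that its interior meets. All scores together are at most
   A (B - 2h) + A + k, which is below ab - Delta(a) when k + 1 is the ceiling of
   a and h is close to 1. Each square scores at least 1: at the bottom, say, the
   area it loses below y = h is at most half its chord there, plus 1/2 if it
   meets a point. The points have spacing A/(k+1) < 1, so a square that misses
   them has a chord shorter than 1 on their line; this line then cuts off the
   lowest corner of the square, and the loss is at most half the chord. *)
Require Import Defs.
From mathcomp Require Import all_boot all_order all_algebra.
From mathcomp Require Import all_classical all_reals all_analysis.
From mathcomp Require Import ring lra.

Set Implicit Arguments.
Unset Strict Implicit.
Unset Printing Implicit Defensive.

Import Order.TTheory GRing.Theory Num.Theory.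
Import numFieldNormedType.Exports.

Local Open Scope ring_scope.

(** * Chord lengths and areas of a tilted unit square *)

Section Profile.
Context {R : realFieldType}.
Implicit Types c s D u v : R.

(* For a unit square whose sides have slopes [s/c] and [-c/s], [width c s D] is
   the length of the horizontal chord at height [D] above the lowest vertex, and
   [area_below c s D] is the area of the square below that chord. *)
Definition width c s D : R :=
  if (D <= 0) || (c + s <= D) then 0 else
  if D < s then D / (c * s) else
  if D <= c then c^-1 else (c + s - D) / (c * s).

Definition area_below c s D : R :=
  if D <= 0 then 0 else
  if D < s then D ^+ 2 / (2 * (c * s)) else
  if D <= c then (D - s / 2) / c else
  if D < c + s then 1 - (c + s - D) ^+ 2 / (2 * (c * s)) else 1.

(* The rotation by [theta], with [c = |cos theta|] and [s = |sin theta|] after a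
   possible quarter turn. *)
Definition tilt c s := [/\ 0 <= s, s <= c & c ^+ 2 + s ^+ 2 = 1].

(** Rational stand-ins for square roots, usable by [lra] and [nra]: [7 / 10] is just below $1/\sqrt
    2$ and [17 / 12] just above $\sqrt 2$. *)
Lemma tilt_bounds c s : tilt c s ->
  [/\ 0 <= s, s <= c, c <= 1, 7 / 10 <= c & 1 <= c + s <= 17 / 12].
Proof.
move=> [s0 sc cs1].
have c0 : 0 <= c by lra.
have c1 : c <= 1 by rewrite leNgt; apply/negP => ?; have := sqr_ge0 s; nra.
have ss_cc : s ^+ 2 <= c ^+ 2 by rewrite lerXn2r.
split=> //; first by rewrite leNgt; apply/negP => ?; nra.
have := sqr_ge0 (c - s); rewrite sqrrB => ?.
have := mulr_ge0 s0 c0 => ?.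
by apply/andP; split; nra.
Qed.

Lemma width_out c s D : (D <= 0) || (c + s <= D) -> width c s D = 0.
Proof. by rewrite /width => ->. Qed.

Lemma width_low c s D : tilt c s -> 0 < D < s -> width c s D = D / (c * s).
Proof.
move=> cs.
have [s0 sc c_le1 c_ge /andP[sum_ge1 sum_le]] := tilt_bounds cs.
have c_gt0 : 0 < c by lra.
move=> /andP[D0 Ds]; rewrite /width ifF ?Ds//.
by apply/negbTE; rewrite negb_or -!ltNge; lra.
Qed.

Lemma width_mid c s D : tilt c s -> 0 < D -> s <= D <= c -> D < c + s -> width c s D = c^-1.
Proof.
move=> cs.
have [s0 sc c_le1 c_ge /andP[sum_ge1 sum_le]] := tilt_bounds cs.
have c_gt0 : 0 < c by lra.
move=> D0 /andP[sD Dc] Dcs; rewrite /width ifF ?[D < s]ltNge ?sD ?Dc//.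
by apply/negbTE; rewrite negb_or -!ltNge; lra.
Qed.

Lemma width_high c s D : tilt c s -> c < D < c + s -> width c s D = (c + s - D) / (c * s).
Proof.
move=> cs.
have [s0 sc c_le1 c_ge /andP[sum_ge1 sum_le]] := tilt_bounds cs.
have c_gt0 : 0 < c by lra.
move=> /andP[cD Dcs]; rewrite /width ifF; last first.
  by apply/negbTE; rewrite negb_or -!ltNge; lra.
by rewrite ltNge (le_trans sc (ltW cD)) leNgt cD.
Qed.

(** The half-turn about the centre of the square. With [area_below_sym] it reduces the loss at the
    top of a square to the loss at the bottom. *)
Lemma width_sym c s D : tilt c s -> width c s (c + s - D) = width c s D.
Proof.
move=> cs.
have [s0 sc c_le1 c_ge /andP[sum_ge1 sum_le]] := tilt_bounds cs.
have c_gt0 : 0 < c by lra.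
have [D0|D0] := leP D 0; first by rewrite !width_out ?D0// orbC; lra.
have [D1|D1] := leP (c + s) D; first by rewrite !width_out ?D1 ?orbT//; lra.
have [Ds|sD] := ltP D s.
  by rewrite (width_high cs) ?(width_low cs); [congr (_ / _); ring|lra|lra].
have [Dc|cD] := leP D c; first by rewrite !(width_mid cs)//; lra.
by rewrite (width_low cs) ?(width_high cs); [|lra|lra].
Qed.

Lemma width_ge0 c s D : tilt c s -> 0 <= width c s D.
Proof.
move=> cs.
have [s0 sc c_le1 c_ge /andP[sum_ge1 sum_le]] := tilt_bounds cs.
have c_gt0 : 0 < c by lra.
rewrite /width; case: ifP => // /negbT; rewrite negb_or -!ltNge => /andP[D0 D1].
have cs0 : 0 <= c * s by rewrite mulr_ge0// ltW.
case: ifP => _; first by rewrite divr_ge0// ltW.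
case: ifP => _; first by rewrite invr_ge0 ltW.
by rewrite divr_ge0//; lra.
Qed.

Lemma area_below0 c s D : D <= 0 -> area_below c s D = 0.
Proof. by rewrite /area_below => ->. Qed.

Lemma area_below_low c s D : tilt c s -> 0 <= D <= s ->
  area_below c s D = D ^+ 2 / (2 * (c * s)).
Proof.
move=> cs.
have [s0 sc c_le1 c_ge /andP[sum_ge1 sum_le]] := tilt_bounds cs.
have c_gt0 : 0 < c by lra.
move=> /andP[D0 Ds]; rewrite /area_below; case: (leP D 0) => D0'.
  by rewrite (_ : D = 0) ?expr2 ?mul0r//; lra.
case: (ltP D s) => // sD; have -> : D = s by lra.
by rewrite sc; field; apply/andP; split; lra.
Qed.

Lemma area_below_mid c s D : tilt c s -> s <= D <= c -> area_below c s D = (D - s / 2) / c.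
Proof.
move=> cs.
have [s0 sc c_le1 c_ge /andP[sum_ge1 sum_le]] := tilt_bounds cs.
have c_gt0 : 0 < c by lra.
move=> /andP[sD Dc]; rewrite /area_below; case: (leP D 0) => D0.
  have -> : D = 0 by lra.
  have -> : s = 0 by lra.
  by rewrite mul0r subr0 mul0r.
by rewrite ltNge sD Dc.
Qed.

Lemma area_below_high c s D : tilt c s -> c <= D <= c + s ->
  area_below c s D = 1 - (c + s - D) ^+ 2 / (2 * (c * s)).
Proof.
move=> cs.
have [s0 sc c_le1 c_ge /andP[sum_ge1 sum_le]] := tilt_bounds cs.
have c_gt0 : 0 < c by lra.
move=> /andP[cD Dcs]; rewrite /area_below.
rewrite leNgt (lt_le_trans c_gt0 cD) /= ltNge (le_trans sc cD) /=.
case: (leP D c) => Dc; last first.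
  case: (ltP D (c + s)) => // Dcs'; have -> : c + s - D = 0 by lra.
  by rewrite expr2 !mul0r subr0.
have -> : D = c by lra.
have [->|sN0] := eqVneq s 0; last by field; rewrite sN0 /=; lra.
rewrite addr0 subrr expr2 !(mul0r, subr0) divff//; lra.
Qed.

Lemma area_below1 c s D : tilt c s -> c + s <= D -> area_below c s D = 1.
Proof.
move=> cs.
have [s0 sc c_le1 c_ge /andP[sum_ge1 sum_le]] := tilt_bounds cs.
have c_gt0 : 0 < c by lra.
move=> csD; have [->|DN] := eqVneq D (c + s).
  by rewrite (area_below_high cs) ?subrr ?expr2 ?mul0r ?subr0//; lra.
have csD' : c + s < D by rewrite lt_neqAle csD eq_sym DN.
rewrite /area_below ifF; last by apply/negbTE; rewrite -ltNge; lra.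
rewrite ifF; last by apply/negbTE; rewrite -leNgt; lra.
rewrite ifF; last by apply/negbTE; rewrite -ltNge; lra.
by rewrite ltNge csD.
Qed.

Lemma area_below_sym c s D : tilt c s -> area_below c s (c + s - D) = 1 - area_below c s D.
Proof.
move=> cs.
have [s0 sc c_le1 c_ge /andP[sum_ge1 sum_le]] := tilt_bounds cs.
have c_gt0 : 0 < c by lra.
have [D0|D0] := leP D 0; first by rewrite (area_below1 cs) ?area_below0 ?subr0//; lra.
have [Ds|sD] := leP D s.
  rewrite (area_below_high cs) ?(area_below_low cs); [|lra|lra].
  by rewrite (_ : c + s - (c + s - D) = D)//; ring.
have [Dc|cD] := leP D c.
  by rewrite !(area_below_mid cs); [field|lra|lra]; lra.
have [Dcs|csD] := leP D (c + s).
  by rewrite (area_below_low cs) ?(area_below_high cs); [ring|lra|lra].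
by rewrite area_below0 ?(area_below1 cs) ?subrr//; lra.
Qed.

(* [width] is affine between breakpoints, so the midpoint rule is exact. *)
Lemma area_below_diff c s u v : tilt c s -> u <= v ->
  (forall e, e \in [:: 0; s; c; c + s] -> ~~ (u < e < v)) ->
  area_below c s v - area_below c s u = (v - u) * width c s ((u + v) / 2).
Proof.
move=> cs.
have [s0 sc c_le1 c_ge /andP[sum_ge1 sum_le]] := tilt_bounds cs.
have c_gt0 : 0 < c by lra.
rewrite le_eqVlt => /predU1P[->|uv] nob; first by rewrite !subrr mul0r.
have out e : e \in [:: 0; s; c; c + s] -> v <= e \/ e <= u.
  by move=> /nob; rewrite negb_and -!leNgt => /orP[]; [right|left].
have [v0|u0] : v <= 0 \/ 0 <= u by apply: out; rewrite !inE eqxx.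
  by rewrite !area_below0 ?width_out ?subrr ?mulr0//; lra.
have [vs|us] : v <= s \/ s <= u by apply: out; rewrite !inE eqxx ?orbT.
  rewrite !(area_below_low cs) ?(width_low cs); [|lra|lra|lra].
  by field; apply/andP; split; lra.
have [vc|uc] : v <= c \/ c <= u by apply: out; rewrite !inE eqxx ?orbT.
  rewrite !(area_below_mid cs) ?(width_mid cs); [|lra|lra|lra|lra|lra].
  by field; lra.
have [vcs|ucs] : v <= c + s \/ c + s <= u by apply: out; rewrite !inE eqxx ?orbT.
  rewrite !(area_below_high cs) ?(width_high cs); [|lra|lra|lra].
  by field; apply/andP; split; lra.
by rewrite !(area_below1 cs) ?width_out ?subrr ?mulr0//; lra.
Qed.

Lemma area_below_hit c s D : tilt c s -> D < 1 ->
  area_below c s D <= width c s D / 2 + 1 / 2.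
Proof.
move=> cs; have [_ _ cs1] := cs.
have [s0 sc c_le1 c_ge /andP[sum_ge1 sum_le]] := tilt_bounds cs.
have c_gt0 : 0 < c by lra.
move=> D1; have [D0|D0] := leP D 0.
  by rewrite area_below0//; have := width_ge0 D cs; lra.
have [Ds|sD] := ltP D s.
  rewrite (area_below_low cs) ?(width_low cs); [|lra|lra].
  have cs0 : 0 < c * s by rewrite mulr_gt0//; lra.
  rewrite (_ : D ^+ 2 / (2 * (c * s)) = D / (c * s) / 2 * D); last by field; lra.
  rewrite -subr_ge0 (_ : _ - _ = D / (c * s) / 2 * (1 - D) + 1 / 2); last by ring.
  by rewrite addr_ge0// mulr_ge0 ?divr_ge0//; lra.
have [Dc|cD] := leP D c.
  rewrite (area_below_mid cs) ?(width_mid cs); [|lra|lra|lra|lra].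
  rewrite ler_pdivrMr//.
  rewrite (_ : (c^-1 / 2 + 1 / 2) * c = 1 / 2 + c / 2); last by field; lra.
  by lra.
rewrite (area_below_high cs) ?(width_high cs); [|lra|lra].
have cs0 : 0 < c * s by rewrite mulr_gt0//; lra.
rewrite -subr_ge0 (_ : _ - _ =
  ((c + s - D) ^+ 2 + (c + s - D) - c * s) / (2 * (c * s))); last by field; lra.
rewrite divr_ge0//; last lra.
(* Put [S = c + s >= 1]. As [D < 1], [x = c + s - D] exceeds [S - 1], so [x^2 + x >= (S - 1) S >= (S
   - 1) (S + 1) / 2 = c s]. *)
have : c * s = ((c + s) ^+ 2 - 1) / 2 by nra.
by nra.
Qed.

(* Any constant between [(sqrt 2 - 1)^2 / 2] and [(sqrt 2 - 1) / 2] can replace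
   [1 / 8]. The hypothesis forces the chord at depth [D - 1 / 8] to cut off a
   corner, which has to be the lowest one because [D < 1]. *)
Lemma area_below_nohit c s D : tilt c s -> D < 1 -> width c s (D - 1 / 8) < 1 ->
  area_below c s D <= width c s D / 2.
Proof.
move=> cs; have [_ _ cs1] := cs.
have [s0 sc c_le1 c_ge /andP[sum_ge1 sum_le]] := tilt_bounds cs.
have c_gt0 : 0 < c by lra.
move=> D1 wD; have [D0|D0] := leP D 0.
  by rewrite area_below0//; have := width_ge0 D cs; lra.
have [Ds|sD] := ltP D s.
  rewrite (area_below_low cs) ?(width_low cs); [|lra|lra].
  have cs0 : 0 < c * s by rewrite mulr_gt0//; lra.
  rewrite (_ : D ^+ 2 / (2 * (c * s)) = D / (c * s) / 2 * D); last by field; lra.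
  by rewrite ler_piMr ?divr_ge0//; lra.
have cs_le : c * s <= 1 / 2 by nra.
have small : D <= 1 / 8 + c * s \/ c + s <= D.
  have [?|D8] := leP (D - 1 / 8) 0; first by left; nra.
  have [?|?] := leP (c + s) D; [by right|left].
  have [Ds'|sD'] := ltP (D - 1 / 8) s.
    move: wD; rewrite (width_low cs) ?D8// ltr_pdivrMr ?mul1r; first by lra.
    by rewrite mulr_gt0//; lra.
  have [Dc|cD] := leP (D - 1 / 8) c.
    move: wD; rewrite (width_mid cs) ?sD' ?Dc//; last lra.
    by rewrite invf_lt1//; lra.
  move: wD; rewrite (width_high cs); last lra.
  rewrite ltr_pdivrMr ?mul1r; last by rewrite mulr_gt0//; lra.
  (* A short chord near the top would give, with [S = c + s], [S - 7/8 < (S^2 - 1) / 2], that is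
     [(S - 1)^2 > 1/4], against [S <= 17/12]. *)
  have : c * s = ((c + s) ^+ 2 - 1) / 2 by nra.
  by nra.
case: small => [Dle|]; last lra.
have [Dc|cD] := leP D c.
  rewrite (area_below_mid cs) ?(width_mid cs); [|lra|lra|lra|lra].
  rewrite ler_pdivrMr// mulrAC mulVf; last lra.
  by nra.
(* Here [D > c >= 7/10], but [1/8 + c s <= 5/8]. *)
by exfalso; nra.
Qed.

End Profile.

(** * Cavalieri's principle for a horizontal strip *)

Lemma sum_area_below_le (R : realFieldType) n (c s y : 'I_n -> R) (A u v : R) :
  (forall i, tilt (c i) (s i)) -> u <= v ->
  (forall t, \sum_i width (c i) (s i) (t - y i) <= A) ->
  \sum_i (area_below (c i) (s i) (v - y i) - area_below (c i) (s i) (u - y i))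
    <= A * (v - u).
Proof.
move=> cs uv slice.
(* [E] has to cover only the breakpoints strictly between [u] and [v]; after a cut at its head, the
   tail suffices for both pieces. *)
suff H (E : seq R) : forall u v, u <= v ->
    (forall i e, e \in [:: 0; s i; c i; c i + s i] ->
      u < y i + e < v -> y i + e \in E) ->
    \sum_i (area_below (c i) (s i) (v - y i) - area_below (c i) (s i) (u - y i))
      <= A * (v - u).
  apply: (H [seq y i + e | i <- enum 'I_n, e <- [:: 0; s i; c i; c i + s i]]) => //.
  by move=> i e ei _; apply/allpairsPdep; exists i, e; rewrite mem_enum.
elim: E => [|e E IH] {uv}u {}v uv brk.
  rewrite (eq_bigr (fun i => (v - u) * width (c i) (s i) ((u + v) / 2 - y i))).
    by rewrite -mulr_sumr mulrC ler_wpM2r// subr_ge0.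
  move=> i _; rewrite area_below_diff//; [|lra|].
    by congr (_ * width _ _ _); [ring|field].
  by move=> x xi; apply/negP => x_in; have := brk i x xi; rewrite in_nil; lra.
have [/andP[ue ev]|out] := boolP (u < e < v).
  rewrite (eq_bigr (fun i =>
    (area_below (c i) (s i) (e - y i) - area_below (c i) (s i) (u - y i)) +
    (area_below (c i) (s i) (v - y i) - area_below (c i) (s i) (e - y i)))).
    rewrite big_split/= (_ : A * (v - u) = A * (e - u) + A * (v - e)); last ring.
    have brk' i x : x \in [:: 0; s i; c i; c i + s i] -> u < y i + x < v ->
        y i + x != e -> y i + x \in E.
      by move=> xi x_in /negbTE xe; have := brk i x xi x_in; rewrite inE xe.
    apply: lerD; (apply: IH; first exact: ltW) => i x xi x_in; apply: brk' => //.
    - by lra.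
    - by rewrite neq_lt; lra.
    - by lra.
    - by rewrite neq_lt; lra.
  by move=> i _; ring.
apply: IH => // i x xi x_in; have := brk i x xi x_in.
by rewrite inE => /predU1P[xe|//]; move: out; rewrite -xe x_in.
Qed.

(** * Chords and extreme vertices of placed squares *)

Section Chords.
Context {R : realType}.
Implicit Types (z p : R * R) (theta c s : R).

Lemma mem_placed_square z theta p :
  `|cos theta * (p.1 - z.1) + sin theta * (p.2 - z.2)| <= 2^-1 ->
  `|cos theta * (p.2 - z.2) - sin theta * (p.1 - z.1)| <= 2^-1 ->
  placed_square z theta p.
Proof.
rewrite !ler_norml => u_in v_in; have cs1 := cos2Dsin2 theta.
move: u_in v_in; set x := p.1 - z.1; set y := p.2 - z.2 => u_in v_in.
exists (cos theta * x + sin theta * y, cos theta * y - sin theta * x).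
  by split; rewrite /= in_itv.
rewrite [LHS]surjective_pairing [RHS]surjective_pairing /rotate /=.
congr pair.
  transitivity (z.1 + (cos theta ^+ 2 + sin theta ^+ 2) * x); first ring.
  by rewrite cs1 /x; ring.
transitivity (z.2 + (cos theta ^+ 2 + sin theta ^+ 2) * y); first ring.
by rewrite cs1 /y; ring.
Qed.

Lemma interior_placed_square z theta p :
  `|cos theta * (p.1 - z.1) + sin theta * (p.2 - z.2)| < 2^-1 ->
  `|cos theta * (p.2 - z.2) - sin theta * (p.1 - z.1)| < 2^-1 ->
  interior (placed_square z theta) p.
Proof.
set U := cos theta * _ + _; set V := cos theta * (p.2 - _) - _ => u_in v_in.
rewrite /interior /=; apply/nbhs_ballP.
(* Moving both coordinates by less than this radius changes either linear form by less than twice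
   the radius, hence by less than its slack. *)
exists (Num.min ((2^-1 - `|U|) / 2) ((2^-1 - `|V|) / 2)) => /=.
  by rewrite lt_min !divr_gt0 ?subr_gt0.
move=> q [/= q1 q2].
have c1 : `|cos theta| <= 1 by rewrite ler_norml cos_geN1 cos_le1.
have s1 : `|sin theta| <= 1 by rewrite ler_norml sin_geN1 sin_le1.
move: q1 q2; rewrite /ball /= !lt_min => /andP[q1u q1v] /andP[q2u q2v].
have bound (x y e w : R) : `|x| <= 1 -> `|y| < e -> `|w| < e ->
    forall k, `|k| <= 1 -> `|x * y + k * w| < e + e.
  move=> x1 ye we k k1; apply: le_lt_trans (ler_normD _ _) _.
  apply: ltrD; rewrite normrM; [apply: le_lt_trans ye|apply: le_lt_trans we].
    by rewrite ler_piMl.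
  by rewrite ler_piMl.
apply: mem_placed_square; apply: ltW.
- rewrite (_ : _ + _ = U - (cos theta * (p.1 - q.1) + sin theta * (p.2 - q.2))).
    apply: le_lt_trans (ler_normB _ _) _.
    by have := bound _ _ _ _ c1 q1u q2u _ s1; lra.
  by rewrite /U; ring.
- rewrite (_ : _ - _ = V - (cos theta * (p.2 - q.2) + - sin theta * (p.1 - q.1))).
    apply: le_lt_trans (ler_normB _ _) _.
    have s1' : `|- sin theta| <= 1 by rewrite normrN.
    by have := bound _ _ _ _ c1 q2v q1v _ s1'; lra.
  by rewrite /V; ring.
Qed.

Lemma tilt_chord c s t : tilt c s -> exists l : R, forall x,
  l < x < l + width c s (t + (c + s) / 2) ->
  `|c * x + s * t| < 2^-1 /\ `|c * t - s * x| < 2^-1.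
Proof.
move=> cs.
have [s0 sc c_le1 c_ge /andP[sum_ge1 sum_le]] := tilt_bounds cs.
have [_ _ cs1] := cs.
have c_gt0 : 0 < c by lra.
(* The half-turn allows [t <= 0]; then the height above the lowest vertex is at most
   [(c + s) / 2 <= c], and the upper range never occurs. *)
wlog t0 : t / t <= 0 => [H|].
  have [t0|/ltW t0] := leP t 0; first exact: H.
  have [|l lP] := H (- t); first lra.
  exists (- (l + width c s (t + (c + s) / 2))) => x x_in.
  have := lP (- x); rewrite (_ : - t + _ = c + s - (t + (c + s) / 2)); last by field.
  rewrite width_sym// => /(_ ltac:(lra)) [].
  rewrite -normrN => h1; rewrite -normrN => h2; split.
    by move: h1; congr (`|_| < _); ring.
  by move: h2; congr (`|_| < _); ring.
(* At the lowest height [width] is 0 even for [s = 0], as it must be: a bottom side has no interior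
   points of the square. *)
have [D0|D0] := leP (t + (c + s) / 2) 0.
  by exists 0 => x; rewrite width_out ?D0//; lra.
have [Ds|sD] := ltP (t + (c + s) / 2) s.
  have s_gt0 : 0 < s by lra.
  (* The chord runs from the side [c x + s t = -1/2] to the side [c t - s x = -1/2]. *)
  exists ((- 2^-1 - s * t) / c) => x; rewrite width_low ?D0//.
  rewrite (_ : _ / c + _ = (c * t + 2^-1) / s); last first.
    apply/eqP; rewrite -subr_eq0; apply/eqP.
    transitivity ((1 - (c ^+ 2 + s ^+ 2)) * t / (c * s)); last first.
      by rewrite cs1 subrr !mul0r.
    by field; apply/andP; split; lra.
  rewrite ltr_pdivrMr// ltr_pdivlMr// => /andP[x1 x2].
  rewrite !ltr_norml; split; apply/andP; split; try lra; nra.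
exists ((- 2^-1 - s * t) / c) => x; rewrite width_mid//; [|lra|lra].
rewrite (_ : _ / c + _ = (2^-1 - s * t) / c); last by field; lra.
rewrite ltr_pdivrMr// ltr_pdivlMr// => /andP[x1 x2].
split; first by rewrite ltr_norml; apply/andP; split; lra.
suff : `|c * (c * t - s * x)| < c * 2^-1.
  by rewrite normrM (gtr0_norm c_gt0) ltr_pM2l.
rewrite (_ : c * (c * t - s * x) = t - s * (c * x + s * t)); last first.
  apply/eqP; rewrite -subr_eq0; apply/eqP.
  transitivity ((c ^+ 2 + s ^+ 2 - 1) * t); first ring.
  by rewrite cs1 subrr mul0r.
have [s_eq0|s_neq0] := eqVneq s 0.
  by rewrite s_eq0 mul0r subr0 ltr_norml; apply/andP; split; lra.
have s_gt0 : 0 < s by rewrite lt_neqAle eq_sym s_neq0.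
have : s * (c * x + s * t) < s * 2^-1 by rewrite ltr_pM2l//; lra.
have : s * - 2^-1 < s * (c * x + s * t) by rewrite ltr_pM2l//; lra.
by move=> ? ?; rewrite ltr_norml; apply/andP; split; lra.
Qed.

(** A negative [s] is reduced to a positive one by the reflection [x -> -x]. *)
Lemma tilt_chord_signed c s t : tilt c `|s| -> exists l : R, forall x,
  l < x < l + width c `|s| (t + (c + `|s|) / 2) ->
  `|c * x + s * t| < 2^-1 /\ `|c * t - s * x| < 2^-1.
Proof.
case: (lerP 0 s) => s0; [rewrite ger0_norm//|rewrite ltr0_norm//];
  move=> /(tilt_chord t)[l lP]; first by exists l.
exists (- (l + width c (- s) (t + (c + - s) / 2))) => x x_in.
have [|h1 h2] := lP (- x); first lra.
split; last by move: h2; congr (`|_| < _); ring.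
by rewrite -normrN; move: h1; congr (`|_| < _); ring.
Qed.

(** Quarter turns only permute the two strip conditions up to sign, so the coefficient of larger
    absolute value can be moved to the place of [c] and made positive. *)
Lemma placed_square_chord z theta : exists c s,
  [/\ tilt c s, c + s = `|cos theta| + `|sin theta| & forall y, exists l, forall x,
    l < x < l + width c s (y - (z.2 - (c + s) / 2)) ->
    interior (placed_square z theta) (x, y)].
Proof.
have cs1 := cos2Dsin2 theta.
have finish (c s : R) : tilt c `|s| ->
    (forall x y, `|c * x + s * y| < 2^-1 -> `|c * y - s * x| < 2^-1 ->
      `|cos theta * x + sin theta * y| < 2^-1 /\
      `|cos theta * y - sin theta * x| < 2^-1) ->
    forall y, exists l, forall x,
      l < x < l + width c `|s| (y - (z.2 - (c + `|s|) / 2)) ->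
      interior (placed_square z theta) (x, y).
  move=> cs xy y; have [l lP] := tilt_chord_signed (y - z.2) cs.
  exists (z.1 + l) => x x_in.
  have [|h1 h2] := lP (x - z.1).
    by move: x_in; rewrite (_ : y - (_ - _) = y - z.2 + (c + `|s|) / 2); [lra|ring].
  by have [? ?] := xy _ _ h1 h2; apply: interior_placed_square.
have [sc|cs] := lerP `|sin theta| `|cos theta|.
  exists `|cos theta|, `|sin theta|; split=> //.
    by split=> //; rewrite !real_normK ?num_real.
  have [c0|c0] := leP 0 (cos theta).
    rewrite (ger0_norm c0) in sc *; apply: finish => //.
    by split=> //; rewrite real_normK ?num_real.
  rewrite (ltr0_norm c0) in sc *; rewrite -(normrN (sin theta)); apply: finish.
    by split; rewrite ?normrN ?sqrrN// real_normK ?num_real.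
  move=> x y h1 h2; split; rewrite -normrN.
    by move: h1; congr (`|_| < _); ring.
  by move: h2; congr (`|_| < _); ring.
exists `|sin theta|, `|cos theta|; split; [|by rewrite addrC|].
  by split; [|exact: ltW|rewrite !real_normK ?num_real// addrC].
have [s0|s0] := leP 0 (sin theta).
  rewrite (ger0_norm s0) in cs *; rewrite -(normrN (cos theta)); apply: finish.
    by split; [|rewrite normrN ltW|rewrite normrN real_normK ?num_real// addrC].
  move=> x y h1 h2; split; last by rewrite -normrN; move: h1; congr (`|_| < _); ring.
  by move: h2; congr (`|_| < _); ring.
rewrite (ltr0_norm s0) in cs *; apply: finish.
  by split; [|exact: ltW|]; rewrite // sqrrN real_normK ?num_real// addrC.
move=> x y h1 h2; split; first by rewrite -normrN; move: h2; congr (`|_| < _); ring.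
by move: h1; congr (`|_| < _); ring.
Qed.

(** The highest vertex takes the signs of the coefficients [sin theta] and [cos theta] of the second
    coordinate; the lowest one is opposite. *)
Lemma placed_square_extremes z theta : exists p q,
  [/\ placed_square z theta p, placed_square z theta q,
      p.2 = z.2 - (`|cos theta| + `|sin theta|) / 2 &
      q.2 = z.2 + (`|cos theta| + `|sin theta|) / 2].
Proof.
pose e (x : R) : R := if 0 <= x then 2^-1 else - 2^-1.
have e_in x : - 2^-1 <= e x <= 2^-1 by rewrite /e; case: ifP => _; lra.
have eM x : x * e x = `|x| / 2.
  by rewrite /e; have [x0|x0] := leP 0 x; [rewrite ger0_norm//|rewrite ltr0_norm//; ring].
pose w : R * R := (e (sin theta), e (cos theta)).
pose w' : R * R := (- e (sin theta), - e (cos theta)).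
exists (z + rotate theta w'), (z + rotate theta w); split.
- exists w' => //; have := e_in (sin theta); have := e_in (cos theta).
  by split; rewrite /= in_itv /=; apply/andP; split; lra.
- by exists w => //; split; rewrite /= in_itv; exact: e_in.
- by rewrite /rotate /= !mulrN !eM; ring.
- by rewrite /rotate /= !eM; ring.
Qed.

End Chords.

(** * Chords and equally spaced points on one line *)

Lemma sum_disjoint_intervals_le (R : realType) n (l w : 'I_n -> R) (A : R) :
  0 <= A -> (forall i, 0 <= w i) ->
  (forall i x, l i < x < l i + w i -> 0 <= x <= A) ->
  (forall i j x, l i < x < l i + w i -> l j < x < l j + w j -> i = j) ->
  \sum_i w i <= A.
Proof.
move=> A0 w0 inA disj.
pose F i := `]l i, l i + w i[%classic.
have mF i : measurable (F i) by exact: measurable_itv.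
have tF : trivIset [set: 'I_n] F.
  by move=> i j _ _ [x []]; rewrite /F /= !in_itv; exact: disj.
have muF i : lebesgue_measure (F i) = (w i)%:E.
  rewrite lebesgue_measure_itv /= lte_fin ltrDl.
  case: ltP => wi; first by rewrite -EFinB addrAC subrr add0r.
  by congr EFin; apply/le_anti; rewrite w0 wi.
have muA : lebesgue_measure (`[0, A]%classic : set R) = A%:E.
  rewrite lebesgue_measure_itv /= lte_fin; case: ltP => A0'.
    by rewrite sube0.
  by congr EFin; apply/le_anti; rewrite A0 A0'.
rewrite -lee_fin -muA -sumEFin -(eq_bigr _ (fun i _ => muF i)).
rewrite -measure_bigsetU_ord//; apply: le_measure.
- by rewrite inE; apply: bigsetU_measurable => i _; exact: mF.
- by rewrite inE; exact: measurable_itv.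
- elim/big_ind: _ => [x []|X Y hX hY x [/hX|/hY]//|i _ x].
  by rewrite /F /= !in_itv /=; exact: inA.
Qed.

Lemma interval_contains_multiple (R : realType) k (A l w : R) :
  0 < A < k.+1%:R -> 1 <= w -> (forall x, l < x < l + w -> 0 <= x <= A) ->
  exists j : 'I_k, l < j.+1%:R * (A / k.+1%:R) < l + w.
Proof.
move=> /andP[A0 Ak] w1 inA; have k0 : 0 < k.+1%:R :> R by rewrite ltr0n.
set d := A / k.+1%:R.
have d0 : 0 < d by rewrite divr_gt0.
have d1 : d < 1 by rewrite ltr_pdivrMr// mul1r.
have dA : k.+1%:R * d = A by rewrite /d mulrC divfK// gt_eqF.
have l0 : 0 <= l.
  rewrite leNgt; apply/negP => l_lt0.
  have [h|h] := leP (- 1) l.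
    by have /(_ ltac:(lra)) := inA (l / 2); lra.
  by have /(_ ltac:(lra)) := inA (l + 1 / 2); lra.
have lwA : l + w <= A.
  rewrite leNgt; apply/negP => A_lt.
  have [h|h] := leP l A.
    by have /(_ ltac:(lra)) := inA ((A + (l + w)) / 2); lra.
  by have /(_ ltac:(lra)) := inA (l + w / 2); lra.
have /truncn_itv/andP[] : 0 <= l / d by rewrite divr_ge0// ltW.
(* [m.+1 * d] is the first multiple of [d] beyond [l]. It is at most
   [l + d < l + w <= A = k.+1 * d], whence [m < k]. *)
set m := Num.truncn (l / d); rewrite ler_pdivlMr// ltr_pdivrMr// => ml lm.
have mlw : m.+1%:R * d < l + w by rewrite -natr1 mulrDl mul1r; lra.
have mk : (m < k)%N.
  rewrite -ltnS -(ltr_nat R) -(ltr_pM2r d0) dA.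
  exact: lt_le_trans mlw lwA.
by exists (Ordinal mk); rewrite /= lm.
Qed.

(** Double counting: each [j] is charged to at most one [i]. *)
Lemma sum_exists_le (R : numDomainType) n k (r : 'I_n -> 'I_k -> bool) :
  (forall i i' j, r i j -> r i' j -> i = i') ->
  \sum_i ([exists j, r i j] : nat)%:R <= k%:R :> R.
Proof.
move=> r_inj; rewrite -natr_sum ler_nat.
apply: (@leq_trans (\sum_i \sum_j r i j)%N).
  apply: leq_sum => i _; case: existsP => [[j rij]|//].
  by rewrite (bigD1 j)//= rij.
rewrite exchange_big/= -[leqRHS]card_ord -sum1_card; apply: leq_sum => j _.
rewrite (eq_bigr (fun i => if r i j then 1 else 0)%N); last by move=> i _; case: (r i j).
rewrite -big_mkcond/= sum1_card; apply/card_le1_eqP => i i'.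
by rewrite !unfold_in => ri /(r_inj _ _ _ ri).
Qed.

(** * The score of a packing *)

Lemma packs_bound (R : realType) (A B h : R) n k :
  0 < A < k.+1%:R -> h < 1 -> 2 * h <= B -> packs n (rectangle A B) ->
  n%:R <= A * (B - 2 * h) + A + k%:R.
Proof.
move=> Ak h1 hB [z [theta [sub disj]]].
have A0 : 0 <= A by case/andP: Ak => /ltW.
have /choice[c /choice[s csP]] i := placed_square_chord (z i) (theta i).
have cs i : tilt (c i) (s i) by have [] := csP i.
pose y i := (z i).2 - (c i + s i) / 2.
have yP i : 0 <= y i /\ y i + (c i + s i) <= B.
  have [p [q [/sub[_ p_in] /sub[_ q_in] p2 q2]]] :=
    placed_square_extremes (z i) (theta i).
  move: p_in q_in; rewrite /= !in_itv /= p2 q2.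
  by rewrite /y; have [_ -> _] := csP i; lra.
pose In i := interior (placed_square (z i) (theta i)).
have chord t : exists l : 'I_n -> R, forall i x,
    l i < x < l i + width (c i) (s i) (t - y i) -> In i (x, t).
  have /choice[l lP] i := let: And3 _ _ sq := csP i in sq t.
  by exists l.
have InA i x t : In i (x, t) -> 0 <= x <= A.
  by move=> /interior_subset/sub[/=]; rewrite in_itv.
have In_inj i j p : In i p -> In j p -> i = j.
  by move=> ip jp; apply: disj => //; exists p.
have slice t : \sum_i width (c i) (s i) (t - y i) <= A.
  have [l lP] := chord t; apply: (@sum_disjoint_intervals_le _ _ l) => //.
  - by move=> i; exact: width_ge0.
  - by move=> i x /lP/InA.
  - by move=> i j x /lP ix /lP; exact: In_inj.
pose pt (j : 'I_k) : R := j.+1%:R * (A / k.+1%:R).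
pose meets t i := [exists j, `[< In i (pt j, t) >]].
have meetsP t i : ~~ meets t i -> width (c i) (s i) (t - y i) < 1.
  move=> nm; rewrite ltNge; apply: contra nm => w1.
  have [l lP] := chord t.
  have [x x_in|j j_in] := interval_contains_multiple Ak w1 (l := l i).
    exact: InA (lP _ _ x_in).
  by apply/existsP; exists j; apply/asboolP; exact: lP.
have meets_le t : \sum_i (meets t i : nat)%:R <= k%:R :> R.
  apply: sum_exists_le => i i' j /asboolP ij /asboolP; exact: In_inj.
(* This serves both ends: [D] is the depth of the cut measured from the nearer end, and [t] is the
   actual height of the row of points, on whichever side it lies. *)
have below i D t : D < 1 -> width (c i) (s i) (D - 1 / 8) =
      width (c i) (s i) (t - y i) ->
    area_below (c i) (s i) D <=
      width (c i) (s i) D / 2 + (meets t i : nat)%:R / 2.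
  move=> D1 wD; case: (boolP (meets t i)) => [_|/meetsP]; rewrite /=.
    exact: area_below_hit.
  by rewrite -wD mul0r addr0; exact: area_below_nohit.
have score_ge1 i : 1 <=
    (area_below (c i) (s i) (B - h - y i) - area_below (c i) (s i) (h - y i)) +
    (width (c i) (s i) (h - y i) + width (c i) (s i) (B - h - y i)) / 2 +
    ((meets (h - 1 / 8) i : nat)%:R + (meets (B - h + 1 / 8) i : nat)%:R) / 2.
  have [y0 yB] := yP i.
  have h_lt1 : h - y i < 1 by lra.
  have := below i _ (h - 1 / 8) h_lt1; rewrite addrAC => /(_ erefl) bot.
  (* The depth of the line [B - h] below the highest vertex; it is less than 1 since that vertex has
     height at most [B]. *)
  set D := c i + s i - (B - h - y i).
  have D_lt1 : D < 1 by rewrite /D; lra.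
  have := below i _ (B - h + 1 / 8) D_lt1; rewrite -(width_sym (D - 1 / 8)) //.
  rewrite (_ : c i + s i - _ = B - h + 1 / 8 - y i); last by rewrite /D; ring.
  move=> /(_ erefl) top.
  have -> : B - h - y i = c i + s i - D by rewrite /D; ring.
  rewrite area_below_sym// width_sym//; lra.
have := @ler_sum _ _ (index_enum 'I_n) xpredT _ _ (fun i _ => score_ge1 i).
rewrite sumr_const card_ord !big_split/= -!mulr_suml !big_split/=.
have area : _ <= _ := @sum_area_below_le _ _ c s y A h (B - h) cs ltac:(lra) slice.
have := slice h; have := slice (B - h).
have := meets_le (h - 1 / 8); have := meets_le (B - h + 1 / 8).
move: area; rewrite !big_split/=.
rewrite (_ : A * (B - h - h) = A * (B - 2 * h)); last by ring.
lra.
Qed.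

(** * From a fixed rectangle to [nu] *)

Lemma packs_subset (R : realType) n (X Y : set (R * R)) :
  (X `<=` Y)%classic -> packs n X -> packs n Y.
Proof.
move=> XY [z [theta [sub disj]]]; exists z, theta; split=> // i.
exact: subset_trans (sub i) XY.
Qed.

Lemma packable_bound (R : realType) (a b : R) n : 0 < a -> 2 < b ->
  packable a b n -> n%:R < a * b - Delta a.
Proof.
move=> a0 b2 [a' [b' [/andP[a'0 a'a] /andP[b'0 b'b] P]]].
have [k ka] : exists k : nat, (Num.ceil a)%:~R = k.+1%:R :> R.
  have : 0 < Num.ceil a by rewrite ceil_gt0.
  by case: (Num.ceil a) => [[//|k] _|//]; exists k.
have ak : a <= k.+1%:R by rewrite -ka ceil_ge.
(* Raising the height to at least 2 makes room for the two lines: [2 * h <= B] for every [h < 1]. *)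
pose B := Num.max b' 2.
have Bb : B < b by rewrite gt_max b'b.
have B2 : 2 <= B by rewrite le_max lexx orbT.
have PB : packs n (rectangle a' B).
  apply: packs_subset P => p [p1 p2]; split=> //.
  by move: p2; rewrite /= !in_itv /= le_max => /andP[-> ->].
have a'k : 0 < a' < k.+1%:R by rewrite a'0 (lt_le_trans a'a).
(* This [h] makes [B - 2 * h + 1] equal to [(B + b) / 2 - 1], which is below [b - 1]; and [Delta a]
   is [a - k]. *)
have := @packs_bound _ a' B (1 - (b - B) / 4) n k a'k ltac:(lra) ltac:(lra) PB.
rewrite /Delta ka -natr1; move/le_lt_trans; apply.
have : a' * (B - 1 + (b - B) / 2) < a * (b - 1) by apply: ltr_pM; lra.
lra.
Qed.

(** Reflection in the diagonal preserves the unit square and negates angles. *)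
Lemma packable_sym (R : realType) (a b : R) n : packable a b n -> packable b a n.
Proof.
have swap z theta (p : R * R) :
    placed_square z theta p -> placed_square (z.2, z.1) (- theta) (p.2, p.1).
  move=> [q [q1 q2] <-]; exists (q.2, q.1) => //.
  by rewrite /rotate cosN sinN /=; congr pair => /=; ring.
have swapK z theta (p : R * R) :
    placed_square (z.2, z.1) (- theta) (p.2, p.1) -> placed_square z theta p.
  by move=> /swap/=; rewrite opprK -!surjective_pairing.
have swap_int z theta (p : R * R) :
    interior (placed_square (z.2, z.1) (- theta)) p ->
    interior (placed_square z theta) (p.2, p.1).
  rewrite /interior /= => /nbhs_ballP[e e0 eP]; apply/nbhs_ballP; exists e => //.
  by move=> q [q1 q2]; apply: swapK; apply: eP.
move=> [a' [b' [a'P b'P [z [theta [sub disj]]]]]].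
exists b', a'; split=> //.
exists (fun i => ((z i).2, (z i).1)), (fun i => - theta i); split.
  move=> i p p_in.
  have : placed_square (z i) (theta i) (p.2, p.1).
    by apply: swapK; rewrite -surjective_pairing.
  by move=> /sub[]; split.
move=> i j _ _ [p [/swap_int pi /swap_int pj]].
by apply: disj => //; exists (p.2, p.1).
Qed.

Theorem theorem1p1 (R : realType) :
  (forall a b : R, 2 <= a -> 3 <= b ->
     (nu a b)%:R < a * b - Delta a) /\
  (forall a b : R, 3 <= a -> 3 <= b ->
     (nu a b)%:R < a * b - Num.max (Delta a) (Delta b)).
Proof.
have nu_packable (a b : R) : 0 < a -> 0 < b -> packable a b (nu a b).
  by move=> a0 b0; have [] := nu_max a0 b0.
split=> a b a_ge b_ge.
  by apply: packable_bound; [lra|lra|apply: nu_packable; lra].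
have [a_gt2 b_gt2 a0 b0] : [/\ 2 < a, 2 < b, 0 < a & 0 < b] by split; lra.
have Pab := nu_packable a b a0 b0.
have := packable_bound a0 b_gt2 Pab.
have := packable_bound b0 a_gt2 (packable_sym Pab).
rewrite (mulrC b); have [_|_] := leP (Delta a) (Delta b); lra.
Qed.
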